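(* Let $t$ be a term of $\Lambda_B$. If $\Gamma;\Delta\vdash t:A$ is derivable in $\mathbf{DLAL_B}$, then $t$ is strongly normalizable for $\beta\delta$-reduction.
   Context: System $\mathbf{DLAL_B}$. Types: $A,B::=\alpha\mid A\multimap B\mid A\Rightarrow B\mid \S A\mid \forall\alpha.A\mid \mathbf{Bool}$. Terms of $\Lambda_B$: $t,u,v::=x\mid F\mid T\mid \lambda x.t\mid t\,u\mid \mathrm{if}\ t\ \mathrm{then}\ u\ \mathrm{else}\ v$. Besides $\beta$-reduction there is $\delta$-reduction, the contextual closure of $(\mathrm{if}\ T\ \mathrm{then}\ u\ \mathrm{else}\ v)\to u$ and $(\mathrm{if}\ F\ \mathrm{then}\ u\ \mathrm{else}\ v)\to v$; $\beta\delta$-reduction is their union. Judgements are $\Gamma;\Delta\vdash t:A$ where $\Gamma$ (non-linear) and $\Delta$ (linear) assign types to distinct variables, with disjoint domains. Rules: (Id) $;x:A\vdash x:A$. ($\multimap$i) from $\Gamma;\Delta,x:A\vdash t:B$ infer $\Gamma;\Delta\vdash\lambda x.t:A\multimap B$. ($\multimap$e) from $\Gamma_1;\Delta_1\vdash t:A\multimap B$ and $\Gamma_2;\Delta_2\vdash u:A$ infer $\Gamma_1,\Gamma_2;\Delta_1,\Delta_2\vdash t\,u:B$. ($\Rightarrow$i) from $\Gamma,x:A;\Delta\vdash t:B$ infer $\Gamma;\Delta\vdash \lambda x.t:A\Rightarrow B$. ($\Rightarrow$e) from $\Gamma;\Delta\vdash t:A\Rightarrow B$ and $;z:C\vdash u:A$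 infer $\Gamma,z:C;\Delta\vdash t\,u:B$ (the right premise may also be $;\vdash u:A$, with conclusion $\Gamma;\Delta\vdash t\,u:B$). (Weak) from $\Gamma_1;\Delta_1\vdash t:A$ infer $\Gamma_1,\Gamma_2;\Delta_1,\Delta_2\vdash t:A$. (Cntr) from $x_1:A,x_2:A,\Gamma;\Delta\vdash t:B$ infer $x:A,\Gamma;\Delta\vdash t[x/x_1,x/x_2]:B$. ($\S$i) from $;\Gamma,\Delta\vdash t:A$ infer $\Gamma;\S\Delta\vdash t:\S A$ ($\S\Delta$ prefixes $\S$ to every type of $\Delta$). ($\S$e) from $\Gamma_1;\Delta_1\vdash u:\S A$ and $\Gamma_2;x:\S A,\Delta_2\vdash t:B$ infer $\Gamma_1,\Gamma_2;\Delta_1,\Delta_2\vdash t[u/x]:B$. ($\forall$i) from $\Gamma;\Delta\vdash t:A$ infer $\Gamma;\Delta\vdash t:\forall\alpha.A$ if $\alpha$ is not free in $\Gamma,\Delta$. ($\forall$e) from $\Gamma;\Delta\vdash t:\forall\alpha.A$ infer $\Gamma;\Delta\vdash t:A[B/\alpha]$. ($B_0$i) $;\vdash F:\mathbf{Bool}$; ($B_1$i) $;\vdash T:\mathbf{Bool}$. ($B$e) from $\Gamma;\Delta\vdash M_0:\S^k\mathbf{Bool}$ ($k\in\mathbb{N}$), $\Gamma;\Delta\vdash M_1:A$, $\Gamma;\Delta\vdash M_2:A$ infer $\Gamma;\Delta\vdash \mathrm{if}\ M_0\ \mathrm{then}\ M_1\ \mathrm{else}\ M_2:A$. *)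

(* Defs.v *)
From Stdlib Require Import Arith List Permutation.
Import ListNotations.

(** Types and terms are taken up to alpha-equivalence: binders are nameless
    (de Bruijn), and an index that points beyond all enclosing binders is read
    as the name of a free variable.  Hence every inhabitant of [type] or [term]
    is a legal type or term, and the named notations [forall alpha. A] and
    [lambda x. t] are the functions [tall] and [lam] below, which capture a
    given free variable. *)

Inductive type : Type :=
| TVar : nat -> type
| TLolli : type -> type -> type
| TArrow : type -> type -> type
| TPara : type -> type
| TForall : type -> type
| TBool : type.

Definition upr (r : nat -> nat) (n : nat) : nat :=
  match n with 0 => 0 | S m => S (r m) end.

(** Sends the free variable [x] to the index of a new enclosing binder. *)
Definition capture (x : nat) (y : nat) : nat :=
  if y =? x then 0 else S y.

Fixpoint tren (r : nat -> nat) (A : type) : type :=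
  match A with
  | TVar n => TVar (r n)
  | TLolli A B => TLolli (tren r A) (tren r B)
  | TArrow A B => TArrow (tren r A) (tren r B)
  | TPara A => TPara (tren r A)
  | TForall A => TForall (tren (upr r) A)
  | TBool => TBool
  end.

Definition tup (s : nat -> type) (n : nat) : type :=
  match n with 0 => TVar 0 | S m => tren S (s m) end.

Fixpoint tsubst (s : nat -> type) (A : type) : type :=
  match A with
  | TVar n => s n
  | TLolli A B => TLolli (tsubst s A) (tsubst s B)
  | TArrow A B => TArrow (tsubst s A) (tsubst s B)
  | TPara A => TPara (tsubst s A)
  | TForall A => TForall (tsubst (tup s) A)
  | TBool => TBool
  end.

(** A[B/a] *)
Definition tsubst1 (a : nat) (B A : type) : type :=
  tsubst (fun b => if b =? a then B else TVar b) A.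

Definition tall (a : nat) (A : type) : type := TForall (tren (capture a) A).

Fixpoint tfree (a : nat) (A : type) : Prop :=
  match A with
  | TVar n => n = a
  | TLolli A B => tfree a A \/ tfree a B
  | TArrow A B => tfree a A \/ tfree a B
  | TPara A => tfree a A
  | TForall A => tfree (S a) A
  | TBool => False
  end.

Inductive term : Type :=
| Var : nat -> term
| FF : term
| TT : term
| Lam : term -> term
| App : term -> term -> term
| If : term -> term -> term -> term.

Fixpoint ren (r : nat -> nat) (t : term) : term :=
  match t with
  | Var n => Var (r n)
  | FF => FF
  | TT => TT
  | Lam t => Lam (ren (upr r) t)
  | App t u => App (ren r t) (ren r u)
  | If t u v => If (ren r t) (ren r u) (ren r v)
  end.

Definition up (s : nat -> term) (n : nat) : term :=
  match n with 0 => Var 0 | S m => ren S (s m) end.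

Fixpoint subst (s : nat -> term) (t : term) : term :=
  match t with
  | Var n => s n
  | FF => FF
  | TT => TT
  | Lam t => Lam (subst (up s) t)
  | App t u => App (subst s t) (subst s u)
  | If t u v => If (subst s t) (subst s u) (subst s v)
  end.

(** t[u/x] *)
Definition subst1 (x : nat) (u t : term) : term :=
  subst (fun y => if y =? x then u else Var y) t.

(** t[x/x1, x/x2] *)
Definition merge (x x1 x2 : nat) (t : term) : term :=
  subst (fun y => if ((y =? x1) || (y =? x2))%bool then Var x else Var y) t.

Definition lam (x : nat) (t : term) : term := Lam (ren (capture x) t).

(** Contracts the outermost binder of the body of an abstraction, lowering the
    remaining indices; see [beta_lam] for the named form. *)
Definition inst (u t : term) : term :=
  subst (fun n => match n with 0 => u | S m => Var m end) t.

Inductive beta_root : term -> term -> Prop :=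
| beta_root_intro : forall t u, beta_root (App (Lam t) u) (inst u t).

Inductive delta_root : term -> term -> Prop :=
| delta_root_T : forall u v, delta_root (If TT u v) u
| delta_root_F : forall u v, delta_root (If FF u v) v.

Inductive ctx_closure (R : term -> term -> Prop) : term -> term -> Prop :=
| cc_root : forall t t', R t t' -> ctx_closure R t t'
| cc_lam : forall t t', ctx_closure R t t' -> ctx_closure R (Lam t) (Lam t')
| cc_app_l : forall t t' u, ctx_closure R t t' -> ctx_closure R (App t u) (App t' u)
| cc_app_r : forall t u u', ctx_closure R u u' -> ctx_closure R (App t u) (App t u')
| cc_if_c : forall t t' u v, ctx_closure R t t' -> ctx_closure R (If t u v) (If t' u v)
| cc_if_t : forall t u u' v, ctx_closure R u u' -> ctx_closure R (If t u v) (If t u' v)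
| cc_if_e : forall t u v v', ctx_closure R v v' -> ctx_closure R (If t u v) (If t u v').

Definition beta : term -> term -> Prop := ctx_closure beta_root.
Definition delta : term -> term -> Prop := ctx_closure delta_root.
Definition betadelta (t t' : term) : Prop := beta t t' \/ delta t t'.

Definition strongly_normalizable (R : term -> term -> Prop) (t : term) : Prop :=
  Acc (fun t' t => R t t') t.

Definition ctx : Type := list (nat * type).

Definition dom (G : ctx) : list nat := map fst G.

Definition wf_ctx (G D : ctx) : Prop := NoDup (dom G ++ dom D).

Definition para_ctx (D : ctx) : ctx := map (fun b => (fst b, TPara (snd b))) D.

Definition tfree_ctx (a : nat) (G : ctx) : Prop :=
  Exists (fun b => tfree a (snd b)) G.

Definition tparas (k : nat) (A : type) : type := Nat.iter k TPara A.

(** [typing G D t A] is the judgement G; D |- t : A, with G non-linear and D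
    linear.  Contexts are unordered, so [ty_exch] is the only rule added to
    make up for their representation as lists.  The [wf_ctx] premises are what
    makes each conclusion a legal judgement; see [typing_wf]. *)
Inductive typing : ctx -> ctx -> term -> type -> Prop :=
| ty_exch : forall G G' D D' t A,
    Permutation G G' -> Permutation D D' ->
    typing G D t A -> typing G' D' t A
| ty_id : forall x A,
    typing [] [(x, A)] (Var x) A
| ty_lolli_i : forall G D x t A B,
    typing G (D ++ [(x, A)]) t B ->
    typing G D (lam x t) (TLolli A B)
| ty_lolli_e : forall G1 G2 D1 D2 t u A B,
    wf_ctx (G1 ++ G2) (D1 ++ D2) ->
    typing G1 D1 t (TLolli A B) ->
    typing G2 D2 u A ->
    typing (G1 ++ G2) (D1 ++ D2) (App t u) B
| ty_arrow_i : forall G D x t A B,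
    typing (G ++ [(x, A)]) D t B ->
    typing G D (lam x t) (TArrow A B)
| ty_arrow_e : forall G D t u z A B C,
    wf_ctx (G ++ [(z, C)]) D ->
    typing G D t (TArrow A B) ->
    typing [] [(z, C)] u A ->
    typing (G ++ [(z, C)]) D (App t u) B
| ty_arrow_e0 : forall G D t u A B,
    typing G D t (TArrow A B) ->
    typing [] [] u A ->
    typing G D (App t u) B
| ty_weak : forall G1 G2 D1 D2 t A,
    wf_ctx (G1 ++ G2) (D1 ++ D2) ->
    typing G1 D1 t A ->
    typing (G1 ++ G2) (D1 ++ D2) t A
| ty_cntr : forall G D x x1 x2 t A B,
    wf_ctx ((x, A) :: G) D ->
    typing ((x1, A) :: (x2, A) :: G) D t B ->
    typing ((x, A) :: G) D (merge x x1 x2 t) B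
| ty_para_i : forall G D t A,
    typing [] (G ++ D) t A ->
    typing G (para_ctx D) t (TPara A)
| ty_para_e : forall G1 G2 D1 D2 x t u A B,
    wf_ctx (G1 ++ G2) (D1 ++ D2) ->
    typing G1 D1 u (TPara A) ->
    typing G2 ((x, TPara A) :: D2) t B ->
    typing (G1 ++ G2) (D1 ++ D2) (subst1 x u t) B
| ty_forall_i : forall G D a t A,
    ~ tfree_ctx a G -> ~ tfree_ctx a D ->
    typing G D t A ->
    typing G D t (tall a A)
| ty_forall_e : forall G D a t A B,
    typing G D t (tall a A) ->
    typing G D t (tsubst1 a B A)
| ty_F : typing [] [] FF TBool
| ty_T : typing [] [] TT TBool
| ty_if : forall G D k t u v A,
    typing G D t (tparas k TBool) ->
    typing G D u A ->
    typing G D v A ->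
    typing G D (If t u v) A.

Lemma subst_ext : forall t s s', (forall n, s n = s' n) -> subst s t = subst s' t.
Proof.
  induction t; intros s s' H; simpl; f_equal; auto.
  apply IHt; intros [|n]; simpl; [reflexivity | now rewrite H].
Qed.

Lemma ren_ext : forall t r r', (forall n, r n = r' n) -> ren r t = ren r' t.
Proof.
  induction t; intros r r' H; simpl; f_equal; auto.
  apply IHt; intros [|n]; simpl; [reflexivity | now rewrite H].
Qed.

Lemma ren_ren : forall t r r', ren r' (ren r t) = ren (fun n => r' (r n)) t.
Proof.
  induction t; intros r r'; simpl; f_equal; auto.
  rewrite IHt; apply ren_ext; now intros [|n].
Qed.

Lemma subst_ren : forall t r s, subst s (ren r t) = subst (fun n => s (r n)) t.
Proof.
  induction t; intros r s; simpl; f_equal; auto.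
  rewrite IHt; apply subst_ext; now intros [|n].
Qed.

Lemma ren_subst : forall t r s, ren r (subst s t) = subst (fun n => ren r (s n)) t.
Proof.
  induction t; intros r s; simpl; f_equal; auto.
  rewrite IHt; apply subst_ext; intros [|n]; simpl; [reflexivity |].
  now rewrite !ren_ren.
Qed.

Lemma beta_lam : forall x t u, beta (App (lam x t) u) (subst1 x u t).
Proof.
  intros x t u; unfold lam, subst1.
  replace (subst _ t) with (inst u (ren (capture x) t)).
  - apply cc_root; constructor.
  - unfold inst; rewrite subst_ren; apply subst_ext; intros y.
    unfold capture; now destruct (y =? x).
Qed.

Lemma betadelta_ren : forall r t t', betadelta t t' -> betadelta (ren r t) (ren r t').
Proof.
  intros r t t' [H|H]; [left | right]; revert r; unfold beta, delta in *;
    induction H as [t t' H | | | | | |]; intros r; simpl;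
    try (constructor; auto; fail); destruct H; simpl;
    try (apply cc_root; constructor).
  replace (ren r (inst u t)) with (inst (ren r u) (ren (upr r) t)).
  - apply cc_root; constructor.
  - unfold inst; rewrite subst_ren, ren_subst; apply subst_ext; now intros [|n].
Qed.

Lemma betadelta_lam : forall x t t', betadelta t t' -> betadelta (lam x t) (lam x t').
Proof.
  intros x t t' H.
  apply (betadelta_ren (capture x)) in H.
  destruct H as [H|H]; [left | right]; now apply cc_lam.
Qed.

Lemma strongly_normalizable_no_infinite_reduction : forall R t,
  strongly_normalizable R t ->
  ~ exists f : nat -> term, f 0 = t /\ forall n, R (f n) (f (S n)).
Proof.
  intros R t H; induction H as [t _ IH]; intros [f [<- Hf]].
  apply (IH (f 1) (Hf 0)); exists (fun n => f (S n)); auto.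
Qed.

Lemma dom_app : forall G D, dom (G ++ D) = dom G ++ dom D.
Proof. intros; apply map_app. Qed.

Lemma typing_wf : forall G D t A, typing G D t A -> wf_ctx G D.
Proof.
  induction 1; unfold wf_ctx in *; try assumption.
  - eapply Permutation_NoDup; [| exact IHtyping].
    apply Permutation_app; now apply Permutation_map.
  - simpl; constructor; [intros [] | constructor].
  - rewrite dom_app, app_assoc in IHtyping.
    now apply NoDup_app_remove_r in IHtyping.
  - rewrite dom_app, <- app_assoc in IHtyping.
    now apply NoDup_remove_1 in IHtyping.
  - rewrite dom_app in IHtyping; unfold dom, para_ctx in *.
    now rewrite map_map.
  - constructor.
  - constructor.
Qed.

(* Main.v *)
From Stdlib Require Import Arith List Permutation.
Import ListNotations.
Require Import Defs.

(** Girard's reducibility candidates, on untyped terms.  Both arrows are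
    interpreted by the same function space, the modality [TPara] by the identity
    and [TBool] by the set of all strongly normalizable terms.  Conditionals count
    as neutral terms, so that [If t u v] belongs to a candidate as soon as [t] is
    strongly normalizable and [u], [v] belong to it.  Every typing rule is sound
    for this interpretation, and variables belong to all candidates, so a typable
    term belongs to a candidate. *)

Notation sn := (strongly_normalizable betadelta).

(** * Substitution and reduction *)

Lemma subst_subst : forall t s s',
  subst s' (subst s t) = subst (fun n => subst s' (s n)) t.
Proof.
  induction t; intros s s'; simpl; f_equal; auto.
  rewrite IHt; apply subst_ext; intros [|n]; simpl; [reflexivity |].
  now rewrite subst_ren, ren_subst.
Qed.

Lemma subst_id : forall t s, (forall n, s n = Var n) -> subst s t = t.
Proof.
  induction t; intros s H; simpl; f_equal; auto.
  apply IHt; intros [|n]; simpl; [reflexivity | now rewrite H].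
Qed.

Lemma subst_inst : forall s t u,
  subst s (inst u t) = inst (subst s u) (subst (up s) t).
Proof.
  intros s t u; unfold inst; rewrite !subst_subst.
  apply subst_ext; intros [|n]; simpl; [reflexivity |].
  rewrite subst_ren; symmetry; now apply subst_id.
Qed.

Lemma subst_lam : forall s x t,
  subst s (lam x t) =
  Lam (subst (fun y => if y =? x then Var 0 else ren S (s y)) t).
Proof.
  intros s x t; unfold lam; simpl; rewrite subst_ren; f_equal.
  apply subst_ext; intros y; unfold capture; now destruct (y =? x).
Qed.

(** With [subst_lam], this lets the introduction rules for both arrows stay with named variables:
    contracting a substituted abstraction amounts to updating [s] at the bound name. *)
Lemma inst_subst_fresh : forall s x t u,
  inst u (subst (fun y => if y =? x then Var 0 else ren S (s y)) t) =
  subst (fun y => if y =? x then u else s y) t.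
Proof.
  intros s x t u; unfold inst; rewrite subst_subst.
  apply subst_ext; intros y; destruct (y =? x); simpl; [reflexivity |].
  rewrite subst_ren; now apply subst_id.
Qed.

Lemma betadelta_subst : forall t t' s,
  betadelta t t' -> betadelta (subst s t) (subst s t').
Proof.
  intros t t' s [H|H]; [left | right]; revert s; unfold beta, delta in *;
    induction H as [t t' H | | | | | |]; intros s; simpl;
    try (constructor; auto; fail); destruct H; simpl.
  - rewrite subst_inst; apply cc_root; constructor.
  - apply cc_root; constructor.
  - apply cc_root; constructor.
Qed.

Lemma betadelta_Lam_inv : forall t w, betadelta (Lam t) w ->
  exists t', w = Lam t' /\ betadelta t t'.
Proof.
  intros t w [H|H]; inversion H as [? ? R | | | | | |]; subst;
    try (inversion R; fail); eexists; split; try reflexivity;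
    [left | right]; assumption.
Qed.

Lemma betadelta_App_inv : forall t u w, betadelta (App t u) w ->
  (exists b, t = Lam b /\ w = inst u b) \/
  (exists t', w = App t' u /\ betadelta t t') \/
  (exists u', w = App t u' /\ betadelta u u').
Proof.
  intros t u w [H|H]; inversion H as [? ? R | | | | | |]; subst;
    try (inversion R; subst);
    solve [ left; eauto
          | right; left; eexists; split; [reflexivity | (left + right); eassumption]
          | right; right; eexists; split; [reflexivity | (left + right); eassumption] ].
Qed.

(** The two root cases forget whether the condition is [TT] or [FF]; this loses nothing where both
    branches lie in the same candidate. *)
Lemma betadelta_If_inv : forall t u v w, betadelta (If t u v) w ->
  w = u \/ w = v \/
  (exists t', w = If t' u v /\ betadelta t t') \/
  (exists u', w = If t u' v /\ betadelta u u') \/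
  (exists v', w = If t u v' /\ betadelta v v').
Proof.
  intros t u v w [H|H]; inversion H as [? ? R | | | | | |]; subst;
    try (inversion R; subst; auto; fail); do 2 right;
    solve [ left; eexists; split; [reflexivity | (left + right); eassumption]
          | right; left; eexists; split; [reflexivity | (left + right); eassumption]
          | right; right; eexists; split; [reflexivity | (left + right); eassumption] ].
Qed.

Lemma betadelta_App_l : forall t t' u,
  betadelta t t' -> betadelta (App t u) (App t' u).
Proof. intros t t' u [H|H]; [left | right]; now apply cc_app_l. Qed.

(** Each reduction from [t] is mapped by [f], step for step, to one from [f t], so well-foundedness
    is pulled back. *)
Lemma sn_preimage : forall f : term -> term,
  (forall t t', betadelta t t' -> betadelta (f t) (f t')) ->
  forall t, sn (f t) -> sn t.
Proof.
  intros f Hf t H; remember (f t) as w eqn:E; revert t E.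
  induction H as [w _ IH]; intros t ->.
  constructor; intros t' Ht'; exact (IH _ (Hf _ _ Ht') _ eq_refl).
Qed.

(** * Reducibility candidates *)

(** Neutral terms are not introduction forms: applied to an argument or used as a condition, they
    create no redex at the root. *)
Definition neutral (t : term) : Prop :=
  match t with Var _ | App _ _ | If _ _ _ => True | _ => False end.

(** Girard's conditions CR1, CR2 and CR3, in this order. *)
Record candidate (C : term -> Prop) : Prop := {
  cand_sn : forall t, C t -> sn t;
  cand_step : forall t t', C t -> betadelta t t' -> C t';
  cand_neutral : forall t, neutral t -> (forall t', betadelta t t' -> C t') -> C t
}.

Definition fun_space (P Q : term -> Prop) (t : term) : Prop :=
  forall u, P u -> Q (App t u).

Lemma cand_var : forall C n, candidate C -> C (Var n).
Proof.
  intros C n HC; apply (cand_neutral _ HC); [exact I |].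
  intros t' [H|H]; inversion H as [? ? R | | | | | |]; inversion R.
Qed.

Lemma candidate_sn : candidate sn.
Proof.
  split; [auto | | ].
  - intros t t' [H] Ht; exact (H _ Ht).
  - intros t _ H; now constructor.
Qed.

Lemma candidate_fun_space : forall P Q,
  candidate P -> candidate Q -> candidate (fun_space P Q).
Proof.
  intros P Q HP HQ; split.
  - intros t H; apply (sn_preimage (fun t => App t (Var 0))).
    + intros; now apply betadelta_App_l.
    + apply (cand_sn _ HQ), H, cand_var, HP.
  - intros t t' H Ht u Hu.
    eapply (cand_step _ HQ); [exact (H u Hu) | now apply betadelta_App_l].
  (* CR3 by induction on the strong normalizability of the argument. Its membership in [P] stays in
     the goal, because it has to be passed on to each reduct. *)
  - intros t Hn H u Hu; generalize Hu.
    induction (cand_sn _ HP _ Hu) as [u _ IH]; clear Hu; intros Hu.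
    apply (cand_neutral _ HQ); [exact I |].
    intros w Hw; apply betadelta_App_inv in Hw
      as [(b & -> & _) | [(t' & -> & Ht) | (u' & -> & Hu')]].
    + destruct Hn.
    + now apply H.
    + pose proof (cand_step _ HP _ _ Hu Hu') as Pu'; exact (IH _ Hu' Pu' Pu').
Qed.

(** The application is neutral, so its one-step reducts decide. Nested inductions on the strong
    normalizability of body and argument handle inner steps, and the root step is the hypothesis. *)
Lemma fun_space_Lam : forall P Q t, candidate P -> candidate Q ->
  (forall u, P u -> Q (inst u t)) -> fun_space P Q (Lam t).
Proof.
  intros P Q t HP HQ H.
  assert (Ht : sn t).
  (* A variable lies in [P], so this instance of the body lies in [Q] and is strongly
     normalizable. *)
  { apply (sn_preimage (inst (Var 0))).
    - intros; now apply betadelta_subst.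
    - apply (cand_sn _ HQ), H, cand_var, HP. }
  induction Ht as [t _ IHt].
  intros u Hu; generalize Hu.
  induction (cand_sn _ HP _ Hu) as [u _ IHu]; clear Hu; intros Hu.
  apply (cand_neutral _ HQ); [exact I |].
  intros w Hw; apply betadelta_App_inv in Hw
    as [(b & E & ->) | [(w' & -> & Hw') | (u' & -> & Hu')]].
  - injection E as <-; now apply H.
  - apply betadelta_Lam_inv in Hw' as (t' & -> & Ht').
    apply IHt; [exact Ht' | | exact Hu].
    intros x Hx; eapply (cand_step _ HQ); [exact (H x Hx) |].
    now apply betadelta_subst.
  - pose proof (cand_step _ HP _ _ Hu Hu') as Pu'; exact (IHu _ Hu' Pu' Pu').
Qed.

(** Three nested inductions, on the strong normalizability of condition and branches, with CR3 at
    each stage. It works for every candidate because conditionals are neutral, whatever the type of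
    the branches. *)
Lemma cand_If : forall C t u v,
  candidate C -> sn t -> C u -> C v -> C (If t u v).
Proof.
  intros C t u v HC Ht; revert u v; induction Ht as [t _ IHt].
  intros u v Hu; revert v; generalize Hu.
  induction (cand_sn _ HC _ Hu) as [u _ IHu]; clear Hu; intros Hu v Hv.
  generalize Hv.
  induction (cand_sn _ HC _ Hv) as [v _ IHv]; clear Hv; intros Hv.
  apply (cand_neutral _ HC); [exact I |].
  intros w Hw; apply betadelta_If_inv in Hw
    as [-> | [-> | [(t' & -> & R) | [(u' & -> & R) | (v' & -> & R)]]]]; auto.
  - pose proof (cand_step _ HC _ _ Hu R) as Cu'; exact (IHu _ R Cu' Cu' _ Hv).
  - pose proof (cand_step _ HC _ _ Hv R) as Cv'; exact (IHv _ R Cv' Cv').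
Qed.

(** * Interpretation of types *)

Definition valuation : Type := nat -> term -> Prop.

Definition vcons (C : term -> Prop) (rho : valuation) : valuation :=
  fun n => match n with 0 => C | S m => rho m end.

Definition vupd (a : nat) (C : term -> Prop) (rho : valuation) : valuation :=
  fun b => if b =? a then C else rho b.

Fixpoint interp (A : type) (rho : valuation) : term -> Prop :=
  match A with
  | TVar n => rho n
  | TLolli A B | TArrow A B => fun_space (interp A rho) (interp B rho)
  | TPara A => interp A rho
  | TForall A => fun t => forall C, candidate C -> interp A (vcons C rho) t
  | TBool => sn
  end.

Lemma fun_space_iff : forall P P' Q Q',
  (forall t, P t <-> P' t) -> (forall t, Q t <-> Q' t) ->
  forall t, fun_space P Q t <-> fun_space P' Q' t.
Proof.
  intros P P' Q Q' HP HQ t; split; intros H u Hu; apply HQ, H, HP, Hu.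
Qed.

Lemma candidate_interp : forall A rho,
  (forall n, candidate (rho n)) -> candidate (interp A rho).
Proof.
  induction A; intros rho Hrho; simpl; auto using candidate_sn, candidate_fun_space.
  assert (HA : forall C, candidate C -> candidate (interp A (vcons C rho))).
  { intros C HC; apply IHA; intros [|n]; [exact HC | apply Hrho]. }
  split.
  (* CR1 needs one member of the intersection; [sn] is a candidate at hand. *)
  - intros t Ht; exact (cand_sn _ (HA _ candidate_sn) _ (Ht _ candidate_sn)).
  - intros t t' Ht R C HC; exact (cand_step _ (HA C HC) _ _ (Ht C HC) R).
  - intros t Hn Ht C HC; apply (cand_neutral _ (HA C HC)); auto.
Qed.

(** Predicates are compared by pointwise equivalence, which avoids extensionality axioms. The
    restriction to free variables serves the side condition of the introduction rule for the
    quantifier. *)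
Lemma interp_ext_free : forall A rho rho',
  (forall n, tfree n A -> forall t, rho n t <-> rho' n t) ->
  forall t, interp A rho t <-> interp A rho' t.
Proof.
  induction A; intros rho rho' H; simpl in *; auto; try tauto;
    try (apply fun_space_iff; auto; fail).
  intros t; split; intros Ht C HC; generalize (Ht C HC);
    apply IHA; intros [|m] Hm w; simpl; try tauto; specialize (H m Hm w); tauto.
Qed.

Lemma interp_ext : forall A rho rho',
  (forall n t, rho n t <-> rho' n t) ->
  forall t, interp A rho t <-> interp A rho' t.
Proof. intros A rho rho' H; apply interp_ext_free; auto. Qed.

Lemma interp_tren : forall A r rho t,
  interp (tren r A) rho t <-> interp A (fun n => rho (r n)) t.
Proof.
  induction A; intros r rho; simpl; try tauto;
    try (apply fun_space_iff; auto; fail).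
  - auto.
  - intros t.
    assert (E : forall C w, interp (tren (upr r) A) (vcons C rho) w <->
                            interp A (vcons C (fun n => rho (r n))) w).
    { intros C w; rewrite IHA; apply interp_ext; now intros [|m]. }
    split; intros H C HC; apply E, H, HC.
Qed.

Lemma interp_tsubst : forall A s rho t,
  interp (tsubst s A) rho t <-> interp A (fun n => interp (s n) rho) t.
Proof.
  induction A; intros s rho; simpl; try tauto;
    try (apply fun_space_iff; auto; fail).
  - auto.
  - intros t.
    assert (E : forall C w, interp (tsubst (tup s) A) (vcons C rho) w <->
                            interp A (vcons C (fun n => interp (s n) rho)) w).
    { intros C w; rewrite IHA; apply interp_ext; intros [|m] v; simpl; [tauto |].
      rewrite interp_tren; tauto. }
    split; intros H C HC; apply E, H, HC.
Qed.

Lemma interp_tall : forall a A rho t,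
  interp (tall a A) rho t <->
  forall C, candidate C -> interp A (vupd a C rho) t.
Proof.
  intros a A rho t.
  assert (E : forall C, interp (tren (capture a) A) (vcons C rho) t <->
                        interp A (vupd a C rho) t).
  { intros C; rewrite interp_tren; apply interp_ext; intros b w.
    unfold capture, vupd; destruct (b =? a); simpl; tauto. }
  split; intros H C HC; apply E, H, HC.
Qed.

Lemma interp_tsubst1 : forall a B A rho t,
  interp (tsubst1 a B A) rho t <-> interp A (vupd a (interp B rho) rho) t.
Proof.
  intros a B A rho t; unfold tsubst1; rewrite interp_tsubst.
  apply interp_ext; intros b w; unfold vupd; destruct (b =? a); simpl; tauto.
Qed.

Lemma interp_tparas : forall k A rho, interp (tparas k A) rho = interp A rho.
Proof. induction k; intros A rho; simpl; auto. Qed.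

(** * Soundness *)

Definition ctx_ok (rho : valuation) (s : nat -> term) (G : ctx) : Prop :=
  forall x A, In (x, A) G -> interp A rho (s x).

Lemma ctx_ok_app : forall rho s G D,
  ctx_ok rho s (G ++ D) <-> ctx_ok rho s G /\ ctx_ok rho s D.
Proof.
  intros rho s G D; split.
  - intros H; split; intros x A HI; apply H, in_or_app; auto.
  - intros [H H'] x A HI; apply in_app_or in HI as []; auto.
Qed.

Lemma ctx_ok_cons : forall rho s x A G,
  ctx_ok rho s ((x, A) :: G) <-> interp A rho (s x) /\ ctx_ok rho s G.
Proof.
  intros rho s x A G; split.
  - intros H; split; [apply H; now left | intros y B HI; apply H; now right].
  - intros [H H'] y B [E|HI]; [now injection E as <- <- | now apply H'].
Qed.

Lemma ctx_ok_ext : forall rho s s' G,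
  (forall x, In x (dom G) -> s x = s' x) -> ctx_ok rho s G -> ctx_ok rho s' G.
Proof.
  intros rho s s' G H HG x A HI; rewrite <- H; [now apply HG |].
  exact (in_map fst _ _ HI).
Qed.

Lemma ctx_ok_upd : forall rho s x u G, ~ In x (dom G) ->
  ctx_ok rho s G -> ctx_ok rho (fun y => if y =? x then u else s y) G.
Proof.
  intros rho s x u G Hx; apply ctx_ok_ext; intros y Hy.
  destruct (Nat.eqb_spec y x) as [->|_]; [contradiction | reflexivity].
Qed.

Lemma ctx_ok_perm : forall rho s G G',
  Permutation G G' -> ctx_ok rho s G' -> ctx_ok rho s G.
Proof.
  intros rho s G G' HP H x A HI; apply H; now apply (Permutation_in _ HP).
Qed.

Lemma ctx_ok_para : forall rho s D,
  ctx_ok rho s (para_ctx D) -> ctx_ok rho s D.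
Proof.
  intros rho s D H x A HI; apply (H x (TPara A)).
  apply in_map_iff; now exists (x, A).
Qed.

Lemma ctx_ok_vupd : forall a C rho s G,
  ~ tfree_ctx a G -> ctx_ok rho s G -> ctx_ok (vupd a C rho) s G.
Proof.
  intros a C rho s G Ha H x A HI.
  apply (interp_ext_free A rho); [| now apply H].
  intros n Hn t; unfold vupd; destruct (Nat.eqb_spec n a) as [->|_]; [| tauto].
  destruct Ha; apply Exists_exists; now exists (x, A).
Qed.

(** Induction on the derivation with [rho] and [s] general: quantifier introduction changes [rho],
    while abstraction, contraction and the elimination of [TPara] change [s]. *)
Theorem typing_sound : forall G D t A, typing G D t A ->
  forall rho s, (forall n, candidate (rho n)) ->
  ctx_ok rho s G -> ctx_ok rho s D -> interp A rho (subst s t).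
Proof.
  induction 1; intros rho s Hrho HG HD;
    try (rewrite ctx_ok_app in HG; destruct HG as [HG1 HG2]);
    try (rewrite ctx_ok_app in HD; destruct HD as [HD1 HD2]).
  - eauto using ctx_ok_perm.
  - apply HD; now left.
  - rewrite subst_lam.
    apply fun_space_Lam; auto using candidate_interp.
    intros w Hw; rewrite inst_subst_fresh.
    (* The bound name is distinct from the remaining ones, so updating [s] at [x] leaves their
       values unchanged. *)
    assert (Hx : ~ In x (dom G ++ dom D)).
    { apply typing_wf in H; unfold wf_ctx in H.
      rewrite dom_app, app_assoc in H; simpl in H.
      apply NoDup_remove_2 in H; now rewrite app_nil_r in H. }
    rewrite in_app_iff in Hx.
    apply IHtyping; auto; [now apply ctx_ok_upd; auto |].
    apply ctx_ok_app; split; [now apply ctx_ok_upd; auto |].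
    apply ctx_ok_cons; rewrite Nat.eqb_refl; split; [exact Hw | intros ? ? []].
  - simpl in IHtyping1; apply IHtyping1; auto.
  - rewrite subst_lam.
    apply fun_space_Lam; auto using candidate_interp.
    intros w Hw; rewrite inst_subst_fresh.
    assert (Hx : ~ In x (dom G ++ dom D)).
    { apply typing_wf in H; unfold wf_ctx in H.
      rewrite dom_app, <- app_assoc in H; now apply NoDup_remove_2 in H. }
    rewrite in_app_iff in Hx.
    apply IHtyping; auto; [| now apply ctx_ok_upd; auto].
    apply ctx_ok_app; split; [now apply ctx_ok_upd; auto |].
    apply ctx_ok_cons; rewrite Nat.eqb_refl; split; [exact Hw | intros ? ? []].
  - simpl in IHtyping1; apply IHtyping1; auto.
    apply IHtyping2; auto; intros ? ? [].
  - simpl in IHtyping1; apply IHtyping1; auto.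
    apply IHtyping2; auto; intros ? ? [].
  - auto.
  - apply ctx_ok_cons in HG as [Hx HG].
    unfold merge; rewrite subst_subst.
    apply typing_wf in H0; unfold wf_ctx in H0; simpl in H0.
    inversion H0 as [| ? ? N1 H1]; inversion H1 as [| ? ? N2 _]; subst.
    simpl in N1; rewrite in_app_iff in N1, N2.
    (* The composed substitution sends [x1] and [x2] to [s x]; distinctness of names makes it agree
       with [s] on the rest of the contexts. *)
    assert (Hext : forall y, In y (dom G) \/ In y (dom D) ->
      s y = subst s (if ((y =? x1) || (y =? x2))%bool then Var x else Var y)).
    { intros y Hy; destruct (Nat.eqb_spec y x1) as [->|_]; [tauto |].
      destruct (Nat.eqb_spec y x2) as [->|_]; [tauto | reflexivity]. }
    apply IHtyping; auto.
    + apply ctx_ok_cons; rewrite Nat.eqb_refl; split; [exact Hx |].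
      apply ctx_ok_cons; rewrite Nat.eqb_refl, Bool.orb_true_r; split; [exact Hx |].
      apply (ctx_ok_ext rho s); auto.
    + apply (ctx_ok_ext rho s); auto.
  - apply IHtyping; auto; [intros ? ? [] |].
    apply ctx_ok_app; auto using ctx_ok_para.
  - apply typing_wf in H1; unfold wf_ctx in H1; simpl in H1.
    apply NoDup_remove_2 in H1; rewrite in_app_iff in H1.
    unfold subst1; rewrite subst_subst.
    (* The cut becomes an update of [s] at [x] by the reducible term [subst s u]. *)
    rewrite (subst_ext t _ (fun y => if y =? x then subst s u else s y))
      by (intros y; now destruct (y =? x)).
    apply IHtyping2; auto; [now apply ctx_ok_upd; auto |].
    apply ctx_ok_cons; rewrite Nat.eqb_refl; split; [now apply IHtyping1 |].
    apply ctx_ok_upd; auto.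
  - apply interp_tall; intros C HC.
    apply IHtyping; auto using ctx_ok_vupd.
    intros n; unfold vupd; now destruct (n =? a).
  - apply interp_tsubst1.
    pose proof (IHtyping rho s Hrho HG HD) as Ht; rewrite interp_tall in Ht.
    (* Impredicativity enters here: the quantifier is instantiated with the interpretation of [B],
       itself a candidate. *)
    apply Ht, candidate_interp, Hrho.
  - constructor.
    intros t' [R|R]; inversion R as [? ? R' | | | | | |]; inversion R'.
  - constructor.
    intros t' [R|R]; inversion R as [? ? R' | | | | | |]; inversion R'.
  - simpl; apply cand_If; auto using candidate_interp.
    specialize (IHtyping1 rho s Hrho HG HD); now rewrite interp_tparas in IHtyping1.
Qed.

Theorem theorem2 (G D : ctx) (t : term) (A : type)
  (Ht : typing G D t A) : strongly_normalizable betadelta t.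
Proof.
  (* Soundness is applied at a constant valuation and the identity substitution, admissible since
     variables lie in all candidates. *)
  pose (rho := (fun _ => sn) : valuation).
  assert (Hrho : forall n, candidate (rho n)) by (intros; apply candidate_sn).
  assert (Hctx : forall E, ctx_ok rho Var E)
    by (intros E x B _; apply cand_var, candidate_interp, Hrho).
  rewrite <- (subst_id t Var) by reflexivity.
  apply (cand_sn _ (candidate_interp A rho Hrho)).
  exact (typing_sound G D t A Ht rho Var Hrho (Hctx G) (Hctx D)).
Qed.
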